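(* For all $n,d\ge1$ and $k\ge0$, the poset $\Pi_n^{1,d}$ is ranked, and $$W_k(\Pi_n^{1,d}) = {n \brace n-kd}_{\{1,d+1,2d+1,\dots\}},\qquad w_k(\Pi_n^{1,d}) = {n \brace n-kd}^{-1}_{\{1,d+1,2d+1,\dots\}}.$$ In particular, $w_k(\Pi_n^{1,d})$ is $(-1)^k$ times the number of forests consisting of an unordered collection of $n-kd$ rooted trees with ordered children, with $n$ leaves in total labeled bijectively by $[n]$ so that in each set of siblings $\ell_{\max}$ increases from left to right, in which every vertex has $0$ or $d+1$ children and every left-most child is a leaf.
   Context: $\Pi_n^{1,d}$ is the set of all set partitions of $[n]$ in which every block has size congruent to $1 \bmod d$, ordered by refinement ($\sigma\le\tau$ iff every block of $\sigma$ is contained in a block of $\tau$); its minimum is the partition into singletons. For a finite ranked poset $P$ with minimum $0$, the $k$th Whitney number of the second kind $W_k(P)$ is the number of elements of rank $k$, and the $k$th Whitney number of the first kind is $w_k(P)=\sum_{x:\,\mathrm{rank}(x)=k}\mu(0,x)$ with $\mu$ the Möbius function of $P$. For $S\subseteq\mathbb N$, ${n \brace m}_S$ is the number of partitions of $[n]$ into $m$ nonempty blocks each of size in $S$ (taken to be $0$ if $m\le 0$), and ${n \brace m}^{-1}_S$ is the $(n,m)$ entry of the inverse of the infinite lower-triangular matrix $[{n \brace m}_S]_{n,m\ge1}$ (taken $0$ if $m\le0$). Leaves are vertices with no children (isolated roots count as leaves); $\ell_{\max}(v)$ is the maximum label among leaves descended from $v$. *)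

(* Defs.v *)
From HB Require Import structures.
From mathcomp Require Import all_boot all_order all_algebra.
Set Implicit Arguments. Unset Strict Implicit. Unset Printing Implicit Defensive.
Import GRing.Theory Num.Theory.

Section FinPoset.
Variables (T : finType) (A : pred T) (le : rel T) (bot : T).

Definition plt (x y : T) : bool := le x y && (x != y).

Definition covers (x y : T) : bool :=
  [&& A x, A y, plt x y & [forall z, ~~ [&& A z, plt x z & plt z y]]].

Definition is_rank_fun (r : T -> nat) : Prop :=
  r bot = 0%N /\ forall x y, covers x y -> r y = (r x).+1.

Definition ranked : Prop := exists r, is_rank_fun r.

Definition whitney2 (r : T -> nat) (k : nat) : nat :=
  #|[set x | A x & r x == k]|.

(* Moebius function mu(bot, y), by the usual recursion
   mu(bot,bot) = 1, mu(bot,y) = - sum_{bot <= z < y} mu(bot,z);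
   the recursion is fueled by #|T|, which exceeds every chain length. *)
Fixpoint mob_fuel (f : nat) (y : T) : int :=
  match f with
  | 0 => 0%R
  | f'.+1 => if y == bot then 1%R
             else (- \sum_(z : T | [&& A z, le bot z & plt z y]) mob_fuel f' z)%R
  end.

Definition mobius0 (y : T) : int := mob_fuel #|T| y.

Definition whitney1 (r : T -> nat) (k : nat) : int :=
  (\sum_(x : T | A x && (r x == k)) mobius0 x)%R.

End FinPoset.

Definition is_setpart (n : nat) (P : {set {set 'I_n}}) : bool :=
  partition P [set: 'I_n].

Definition in_Pi1d (n d : nat) : pred {set {set 'I_n}} :=
  fun P => is_setpart P && [forall B in P, #|B| == 1 %[mod d]].

Definition refines (n : nat) : rel {set {set 'I_n}} :=
  fun P Q => [forall B in P, exists C in Q, B \subset C].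

Definition singletons (n : nat) : {set {set 'I_n}} := [set [set i] | i : 'I_n].

Definition stirS (S : pred nat) (n : nat) (m : int) : nat :=
  match m with
  | Posz m' => if m' == 0%N then 0%N else
      #|[set P : {set {set 'I_n}} | [&& is_setpart P, #|P| == m'
                                       & [forall B in P, S #|B|]]]|
  | Negz _ => 0%N
  end.

(* (n,m) entry of the inverse of the infinite lower-triangular matrix
   [stirS S n m]_{n,m>=1}; computed from the inverse of its leading n x n
   block (which is the n x n block of the inverse, by lower-triangularity);
   0 if m <= 0 (and 0 if m > n, by lower-triangularity). *)
Definition stirS_inv (S : pred nat) (n : nat) (m : int) : int :=
  match n with
  | 0 => 0%R
  | n'.+1 =>
    match m with
    | Posz m' =>
        if (0 < m')%N && (m' <= n)%N then
          invmx (\matrix_(i < n'.+1, j < n'.+1) (Posz (stirS S i.+1 (Posz j.+1))))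
                (inord n') (inord m'.-1)
        else 0%R
    | Negz _ => 0%R
    end
  end.

Definition S1d (d : nat) : pred nat := fun s => (0 < s)%N && (s == 1 %[mod d]).

(* Trees: GenTree.Leaf i is a leaf labelled i (labels 0..n-1 stand for [n]);
   GenTree.Node 0 ts is an internal vertex with ordered children ts. *)
Notation ptree := (GenTree.tree nat).

Fixpoint leaves (t : ptree) : seq nat :=
  match t with
  | GenTree.Leaf i => [:: i]
  | GenTree.Node _ ts => flatten (map leaves ts)
  end.

Definition lmax (t : ptree) : nat := foldr maxn 0%N (leaves t).

Definition is_leaf (t : ptree) : bool :=
  if t is GenTree.Leaf _ then true else false.

Fixpoint good_tree (d : nat) (t : ptree) : bool :=
  match t with
  | GenTree.Leaf _ => true
  | GenTree.Node tag ts =>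
      [&& tag == 0%N, size ts == d.+1, is_leaf (head t ts),
          sorted ltn (map lmax ts) & all (good_tree d) ts]
  end.

(* An unordered collection of trees is represented canonically by the list of
   its trees sorted by increasing lmax (lmax values of distinct trees differ,
   since leaf labels are distinct). *)
Definition good_forest (n d : nat) (m : int) (f : seq ptree) : bool :=
  [&& (Posz (size f) == m), sorted ltn (map lmax f),
      perm_eq (flatten (map leaves f)) (iota 0 n) & all (good_tree d) f].

(* Main.v *)
Require Import Defs.
From HB Require Import structures.
From mathcomp Require Import all_boot all_order all_algebra.
From mathcomp Require Import zify.
Import GRing.Theory Num.Theory.

Set Implicit Arguments.
Unset Strict Implicit.
Unset Printing Implicit Defensive.

(** Ranks and the matrix inverse: numbering the blocks of a partition P in the
    poset identifies the interval above P with the poset on [#|P|], since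
    unions of j blocks have size congruent to j mod d.  Hence each cover
    removes exactly d blocks, and the defining recursion of the Moebius
    function, summed over partitions with a fixed number of blocks, says that
    the matrix of the w's times the Stirling matrix is the identity.

    Forests: mu(0, P) is the signed number of forests whose trees have the
    blocks of P as leaf sets.  It suffices that the signed number of forests
    whose leaf partition refines Q vanishes when Q has a block C of size > 1.
    List the trees inside C by increasing lmax.  If the first one is not a
    leaf, replace it by its d+1 children; otherwise, merge the first d+1 trees
    under a new root.  This is an involution that reverses signs. *)

(** * Set partitions of [[n]] and refinement *)

Lemma partition_setTP (T : finType) (P : {set {set T}}) :
  reflect [/\ set0 \notin P, forall x, exists2 B, B \in P & x \in B &
     forall x B C, B \in P -> C \in P -> x \in B -> x \in C -> B = C]
    (partition P [set: T]).
Proof.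
apply: (iffP and3P) => [[/eqP cP tP P0]|[P0 cP tP]]; split => //.
- by move=> x; have := in_setT x; rewrite -cP => /bigcupP [B]; exists B.
- move=> x B C BP CP xB xC.
  by rewrite -(def_pblock tP BP xB) -(def_pblock tP CP xC).
- apply/eqP/setP => x; rewrite in_setT; apply/bigcupP.
  by have [B] := cP x; exists B.
- apply/trivIsetP => B C BP CP; apply: contraR => /pred0Pn [x /andP [xB xC]].
  by apply/eqP; apply: tP xB xC.
Qed.

Lemma singletons_partition n : partition (singletons n) [set: 'I_n].
Proof.
apply/partition_setTP; split.
- by apply/imsetP => -[i _ /setP /(_ i)]; rewrite !inE eqxx.
- by move=> i; exists [set i]; rewrite ?set11 ?imset_f.
- by move=> x _ _ /imsetP [i _ ->] /imsetP [j _ ->] /set1P -> /set1P ->.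
Qed.

Lemma card_singletons n : #|singletons n| = n.
Proof. by rewrite card_imset ?card_ord //; apply: set1_inj. Qed.

Lemma partition_card_le n (P : {set {set 'I_n}}) :
  is_setpart P -> (#|P| <= n)%N.
Proof.
move=> pP; have := card_partition pP; rewrite cardsT card_ord => nE.
rewrite [leqRHS]nE -sum1_card leq_sum // => B BP; rewrite card_gt0.
by case/and3P: pP => _ _; apply: contraNneq => <-.
Qed.

(** The block sizes sum to [n] and none is 0, so [n] blocks leave no room for a block of size 2 or
    more. *)
Lemma partition_card_eq n (P : {set {set 'I_n}}) :
  is_setpart P -> #|P| = n -> P = singletons n.
Proof.
move=> pP cP; apply/eqP; rewrite eqEcard card_singletons cP leqnn andbT.
apply/subsetP => B BP.
have/and3P [_ _ P0] := pP.
have gt0 C : C \in P -> (0 < #|C|)%N.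
  by move=> CP; rewrite card_gt0; apply: contraNneq P0 => <-.
have sumP : \sum_(C in P) #|C| = n by rewrite -(card_partition pP) cardsT card_ord.
have /cards1P [x ->]: #|B| == 1.
  rewrite eqn_leq gt0 // andbT -(leq_add2r #|P :\ B|) -[X in (_ <= X)%N]/(1 + _)%N.
  rewrite -[1%N]/(true : nat) -BP -cardsD1 cP -[X in (_ <= X)%N]sumP (bigD1 B) //=.
  rewrite leq_add2l -sum1_card.
  under eq_bigl do rewrite !inE andbC.
  by apply: leq_sum => C /andP [CP _]; apply: gt0.
by apply: imset_f.
Qed.

Lemma partition_card_gt0 {n} (P : {set {set 'I_n}}) :
  (0 < n)%N -> is_setpart P -> (0 < #|P|)%N.
Proof.
case: n P => // n P _ /partition_setTP [_ /(_ ord0) [B BP _] _].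
by apply/card_gt0P; exists B.
Qed.

Lemma refines_refl {n} (P : {set {set 'I_n}}) : refines P P.
Proof. by apply/forall_inP => B BP; apply/exists_inP; exists B. Qed.

Lemma refines_singletons {n} (P : {set {set 'I_n}}) :
  is_setpart P -> refines (singletons n) P.
Proof.
move=> /partition_setTP [_ cP _]; apply/forall_inP => _ /imsetP [i _ ->].
by have [C CP iC] := cP i; apply/exists_inP; exists C => //; rewrite sub1set.
Qed.

(** * Coarsenings of a partition as pullbacks along a surjection *)

Section Pullback.

Variables (n m : nat) (f : 'I_n -> 'I_m).
Hypothesis f_surj : forall y, exists x, f x = y.

Definition pullback (R : {set {set 'I_m}}) : {set {set 'I_n}} :=
  [set f @^-1: (B : {set 'I_m}) | B in R].

Lemma preimset_inj : injective (fun B : {set 'I_m} => f @^-1: B).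
Proof.
move=> B C /setP E; apply/setP => y; have [x <-] := f_surj y.
by have := E x; rewrite !inE.
Qed.

Lemma pullback_inj : injective pullback.
Proof. exact: imset_inj preimset_inj. Qed.

Lemma card_pullback R : #|pullback R| = #|R|.
Proof. exact: card_imset preimset_inj. Qed.

Lemma mem_pullback (R : {set {set 'I_m}}) (B : {set 'I_m}) :
  (f @^-1: B \in pullback R) = (B \in R).
Proof. exact: mem_imset preimset_inj. Qed.

Lemma is_setpart_pullback R : is_setpart (pullback R) = is_setpart R.
Proof.
apply/partition_setTP/partition_setTP => [] [R0 cR tR]; split.
- by apply: contra R0 => R0; rewrite -(preimset0 f) mem_pullback.
- move=> y; have [x <-] := f_surj y; have [_ /imsetP [B BR ->]] := cR x.
  by rewrite inE; exists B.
- move=> y B C BR CR; have [x <-] := f_surj y => xB xC; apply: preimset_inj.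
  by apply: (tR x); rewrite ?mem_pullback ?inE.
- by rewrite -(preimset0 f) mem_pullback.
- move=> x; have [B BR xB] := cR (f x).
  by exists (f @^-1: B); rewrite ?mem_pullback ?inE.
- move=> x _ _ /imsetP [B BR ->] /imsetP [C CR ->]; rewrite !inE => xB xC.
  by rewrite (tR (f x) B C).
Qed.

Lemma refines_pullback R S : refines (pullback R) (pullback S) = refines R S.
Proof.
apply/forall_inP/forall_inP => RS B BR.
- have := RS (f @^-1: B); rewrite mem_pullback => /(_ BR).
  move=> /exists_inP [_ /imsetP [C CS ->] /subsetP BC].
  apply/exists_inP; exists C => //; apply/subsetP => y.
  by have [x <-] := f_surj y => xB; have := BC x; rewrite !inE; apply.
- have /imsetP [C CR ->] := BR; have /exists_inP [D DS CD] := RS C CR.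
  by apply/exists_inP; exists (f @^-1: D); rewrite ?mem_pullback ?preimsetS.
Qed.

Variable d : nat.
Hypothesis f_fib : forall y, #|f @^-1: [set y]| = 1 %[mod d].

(** The preimage is a disjoint union of fibres, one per element of [B], and each fibre contributes 1
    modulo [d]. *)
Lemma card_preimset_mod (B : {set 'I_m}) : #|f @^-1: B| = #|B| %[mod d].
Proof.
have -> : #|f @^-1: B| = (\sum_(y in B) #|f @^-1: [set y]|)%N.
  rewrite -sum1_card (partition_big f (fun y => y \in B)) => [|x]; last by rewrite inE.
  apply: eq_bigr => y yB; rewrite -sum1_card; apply: eq_bigl => x.
  by rewrite !inE; case: eqP => [->|]; rewrite ?yB ?andbF.
rewrite -sum1_card; elim/big_rec2: _ => // y a b _ E.
by rewrite -modnDm f_fib E modnDm.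
Qed.

Lemma in_Pi1d_pullback R : in_Pi1d d (pullback R) = in_Pi1d d R.
Proof.
rewrite /in_Pi1d is_setpart_pullback; congr andb.
apply/forall_inP/forall_inP => RP B BR.
  by rewrite -card_preimset_mod; apply: RP; rewrite mem_pullback.
by have /imsetP [C CR ->] := BR; rewrite card_preimset_mod; apply: RP.
Qed.

(** A block of [Q] that meets a fibre contains it, so every block is the preimage of its image. *)
Lemma pullback_surj Q : is_setpart Q -> refines (pullback (singletons m)) Q ->
  exists R, Q = pullback R.
Proof.
move=> /partition_setTP [_ _ tQ] /forall_inP fQ.
exists [set B : {set 'I_m} | f @^-1: B \in Q]; apply/setP => C.
apply/idP/imsetP => [CQ|[B]]; last by rewrite inE => ? ->.
have CE : C = f @^-1: (f @: C).
  apply/setP => x; rewrite inE; apply/idP/imsetP => [xC|[z zC fxz]].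
    by exists x.
  have /exists_inP [D DQ /subsetP xD] := fQ (f @^-1: [set f x])
    ltac:(by rewrite mem_pullback imset_f).
  by rewrite (tQ z C D) // xD // !inE ?fxz.
by exists (f @: C); rewrite ?inE -?CE.
Qed.

End Pullback.

(** * Intervals, covers and ranks *)

Lemma in_Pi1d_setpart n d (P : {set {set 'I_n}}) : in_Pi1d d P -> is_setpart P.
Proof. by case/andP. Qed.

Lemma in_Pi1d_singletons n d : in_Pi1d d (singletons n).
Proof.
rewrite /in_Pi1d /is_setpart singletons_partition.
by apply/forall_inP => _ /imsetP [i _ ->]; rewrite cards1.
Qed.

(** Here [f] sends each element to the number of its block, so its fibres are the blocks. Everything
    above [P] can then be studied on ['I_#|P|], where [P] becomes the partition into singletons. *)
Lemma in_Pi1d_pullbackE {n d} (P : {set {set 'I_n}}) : in_Pi1d d P ->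
  exists f : 'I_n -> 'I_#|P|,
    [/\ forall y, exists x, f x = y,
        forall y, #|f @^-1: [set y]| = 1 %[mod d] &
        P = pullback f (singletons #|P|)].
Proof.
move=> /andP [pP /forall_inP Pd].
have/and3P [cP tP P0] := pP.
have blk i : pblock P i \in P by rewrite pblock_mem // (eqP cP) inE.
pose f i := enum_rank_in (blk i) (pblock P i).
have fE i : enum_val (f i) = pblock P i by rewrite enum_rankK_in.
have pre y : f @^-1: [set y] = enum_val y.
  have yP := enum_valP y; apply/setP => x; rewrite !inE.
  apply/eqP/idP => [<-|xy]; first by rewrite fE mem_pblock (eqP cP) inE.
  by apply: enum_val_inj; rewrite fE (def_pblock tP yP).
exists f; split.
- move=> y; have yP := enum_valP y.
  have /set0Pn [x xy] : enum_val y != set0 by apply: contraNneq P0 => <-.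
  by exists x; apply/set1P; have := xy; rewrite -(pre y) !inE.
- by move=> y; rewrite pre; apply/eqP/Pd/enum_valP.
- apply/setP => B; apply/idP/imsetP => [BP|[_ /imsetP [y _ ->] ->]].
    exists [set enum_rank_in BP B]; first exact: imset_f.
    by rewrite pre enum_rankK_in.
  by rewrite pre enum_valP.
Qed.

(** Seen on the blocks of [P], [Q] is a partition of [#|P|] points; it has at most [#|P|] blocks,
    with equality only for the singletons, that is for [Q = P]. *)
Lemma refines_lt_card {n d} (P Q : {set {set 'I_n}}) :
  in_Pi1d d P -> is_setpart Q -> plt (@refines n) P Q -> (#|Q| < #|P|)%N.
Proof.
move=> /in_Pi1d_pullbackE [f [fs _ PE]] pQ /andP [PQ neq].
have [|R QE] := pullback_surj (f := f) fs pQ; first by rewrite -PE.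
have pR : is_setpart R by rewrite -(is_setpart_pullback (f := f)) // -QE.
rewrite QE card_pullback // ltn_neqAle partition_card_le // andbT.
by apply: contraNneq neq => /(partition_card_eq pR) RE; rewrite QE RE -PE.
Qed.

(** Pullback along the block numbering is a bijection that keeps the number of blocks. The count
    thus depends on [P] only through [#|P|], which turns sums over intervals into a matrix
    product. *)
Lemma card_above n d (P : {set {set 'I_n}}) j : in_Pi1d d P ->
  #|[set Q : {set {set 'I_n}} | [&& in_Pi1d d Q, refines P Q & #|Q| == j]]| =
  #|[set R : {set {set 'I_#|P|}} | in_Pi1d d R & #|R| == j]|.
Proof.
move=> /in_Pi1d_pullbackE [f [fs fd PE]].
rewrite -(card_imset _ (pullback_inj fs)); congr #|pred_of_set _|.
apply/setP => Q; rewrite inE; apply/and3P/imsetP => [[dQ PQ /eqP Qj]|].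
  have [|R QE] := pullback_surj fs (in_Pi1d_setpart dQ); first by rewrite -PE.
  by exists R; rewrite // inE -(in_Pi1d_pullback fs fd) -QE dQ -Qj QE card_pullback ?eqxx.
move=> [R]; rewrite inE => /andP [dR Rj] ->.
rewrite in_Pi1d_pullback // card_pullback //; split => //.
rewrite [X in refines X]PE refines_pullback // refines_singletons //.
exact: in_Pi1d_setpart dR.
Qed.

Definition merge_block (m : nat) (D : {set 'I_m}) : {set {set 'I_m}} :=
  D |: [set [set i] | i in ~: D].

Lemma merge_block_setpart m (D : {set 'I_m}) : D != set0 -> is_setpart (merge_block D).
Proof.
move=> D0; apply/partition_setTP; split.
- rewrite !inE negb_or eq_sym D0; apply/imsetP => -[i _ /setP /(_ i)].
  by rewrite !inE eqxx.
- move=> x; case: (boolP (x \in D)) => xD; first by exists D; rewrite ?setU11.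
  by exists [set x]; rewrite ?set11 // !inE imset_f ?orbT // inE.
- move=> x B C /setU1P [->|/imsetP [i iD ->]] /setU1P [->|/imsetP [j jD ->]] //.
  + by move=> xD /set1P xj; move: jD; rewrite -xj inE xD.
  + by move=> /set1P xj xD; move: iD; rewrite -xj inE xD.
  + by move=> /set1P -> /set1P ->.
Qed.

Lemma card_merge_block m (D : {set 'I_m}) : (1 < #|D|)%N ->
  (#|merge_block D| + #|D| = m.+1)%N.
Proof.
move=> D1; rewrite cardsU1 (card_imset _ set1_inj).
have -> : D \notin [set [set i] | i in ~: D].
  by apply/imsetP => -[i _ DE]; rewrite DE cards1 in D1.
by have := cardsC D; rewrite card_ord; lia.
Qed.

Lemma in_Pi1d_merge_block m d (D : {set 'I_m}) :
  #|D| = d.+1 -> in_Pi1d d (merge_block D).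
Proof.
move=> cD; rewrite /in_Pi1d merge_block_setpart ?andTb; last first.
  by rewrite -card_gt0 cD.
apply/forall_inP => _ /setU1P [->|/imsetP [i _ ->]]; last by rewrite cards1.
by rewrite cD -addn1 modnDl.
Qed.

Lemma modn1_gt1 d c : c = 1 %[mod d] -> (1 < c)%N -> (d < c)%N.
Proof.
move=> cd c1; have : (d %| c - 1)%N by rewrite -eqn_mod_dvd ?cd ?eqxx // ltnW.
by move/dvdn_leq; rewrite subn_gt0 => /(_ c1); lia.
Qed.

(** Seen on the blocks of [P], some block of [Q] has more than one point, hence at least [d.+1];
    fusing just [d.+1] of these points gives [Z]. *)
Lemma refines_lt_merge n d (P Q : {set {set 'I_n}}) : (0 < d)%N ->
  in_Pi1d d P -> in_Pi1d d Q -> plt (@refines n) P Q ->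
  exists Z, [/\ in_Pi1d d Z, plt (@refines n) P Z, refines Z Q & #|P| = #|Z| + d].
Proof.
move=> d0 dP dQ PQ; have PltQ := refines_lt_card dP (in_Pi1d_setpart dQ) PQ.
have [f [fs fd PE]] := in_Pi1d_pullbackE dP.
have [|R QE] := pullback_surj fs (in_Pi1d_setpart dQ).
  by rewrite -PE; case/andP: PQ.
have dR : in_Pi1d d R by rewrite -(in_Pi1d_pullback fs fd) -QE.
have /andP [pR /forall_inP Rd] := dR; have /and3P [_ _ R0] := pR.
have [B BR B1] : exists2 B, B \in R & (1 < #|B|)%N.
  apply/exists_inP; apply: contraLR PltQ => /exists_inPn R1.
  rewrite -leqNgt QE card_pullback //.
  have := card_partition pR; rewrite cardsT card_ord => cR.
  by rewrite [leqLHS]cR -[leqRHS]sum1_card leq_sum // => B /R1; rewrite -leqNgt.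
have /card_gt0P [D] : (0 < #|[set D : {set _} | D \subset B & #|D| == d.+1]|)%N.
  by rewrite cards_draws bin_gt0 modn1_gt1 //; apply/eqP/Rd.
rewrite inE => /andP [DB /eqP cD].
have : (#|merge_block D| + #|D| = #|P|.+1)%N by apply: card_merge_block; rewrite cD.
rewrite cD addnS => -[cM].
have refM S : is_setpart S -> refines (pullback f (singletons #|P|)) (pullback f S).
  by move=> pS; rewrite refines_pullback // refines_singletons.
exists (pullback f (merge_block D)); split.
- by rewrite in_Pi1d_pullback // in_Pi1d_merge_block.
- apply/andP; split.
    by rewrite [X in refines X]PE refM // merge_block_setpart // -card_gt0 cD.
  (* If the merge changed nothing, equal block counts would force [d = 0]. *)
  apply: contraTneq d0 => PM; rewrite -(card_pullback fs) -PM in cM.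
  by move: cM => /eqP; rewrite -[X in _ == X]addn0 eqn_add2l => /eqP ->.
- rewrite QE refines_pullback //; apply/forall_inP => _ /setU1P [->|/imsetP [i _ ->]].
    by apply/exists_inP; exists B.
  have /partition_setTP [_ /(_ i) [C CR iC] _] := pR.
  by apply/exists_inP; exists C => //; rewrite sub1set.
- by rewrite card_pullback // cM.
Qed.

Lemma covers_card n d (P Q : {set {set 'I_n}}) : (0 < d)%N ->
  covers (in_Pi1d d) (@refines n) P Q -> #|P| = #|Q| + d.
Proof.
move=> d0 /and4P [dP dQ PQ /forallP noZ].
have [Z [dZ PZ ZQ ->]] := refines_lt_merge d0 dP dQ PQ; congr (_ + d).
have := noZ Z; rewrite /in_mem /= dZ PZ /= /plt ZQ /= negbK.
by move/eqP => ->.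
Qed.

(** Take an element strictly below [P] with the fewest blocks; anything strictly between would have
    fewer still. *)
Lemma ex_covers n d (P : {set {set 'I_n}}) : in_Pi1d d P -> P != singletons n ->
  exists Q, covers (in_Pi1d d) (@refines n) Q P.
Proof.
move=> dP P1; have pP := in_Pi1d_setpart dP.
pose below (Q : {set {set 'I_n}}) := in_Pi1d d Q && plt (@refines n) Q P.
have b0 : below (singletons n).
  by rewrite /below in_Pi1d_singletons /plt refines_singletons // eq_sym.
case: (arg_minnP (fun Q : {set {set 'I_n}} => #|Q|) b0) => Q /andP [dQ QP] minQ.
exists Q; apply/and4P; split => //; apply/forallP => Z.
apply/negP => /and3P [dZ QZ ZP].
have := minQ Z; rewrite /below ZP andbT => /(_ dZ).
by rewrite leqNgt (refines_lt_card dQ (in_Pi1d_setpart dZ)).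
Qed.

(** Descending by covers, each of which adds [d] blocks and lowers the rank by 1, ends at the
    singletons. *)
Lemma rank_fun_card n d r (P : {set {set 'I_n}}) : (0 < d)%N ->
  is_rank_fun (in_Pi1d d) (@refines n) (singletons n) r ->
  in_Pi1d d P -> (r P * d + #|P| = n)%N.
Proof.
move=> d0 [r0 rS]; move: {2}(n - #|P|)%N (leqnn (n - #|P|)) => N.
elim: N P => [|N IH] P PN dP; have pP := in_Pi1d_setpart dP.
all: have [->|P1] := eqVneq P (singletons n);
  first by rewrite r0 card_singletons.
  case/eqP: P1; apply: partition_card_eq => //.
  by have := partition_card_le pP; lia.
have [Q QP] := ex_covers dP P1; have cQ := covers_card d0 QP.
have dQ : in_Pi1d d Q by case/and4P: QP.
have := partition_card_le (in_Pi1d_setpart dQ); rewrite (rS _ _ QP) => Qn.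
by have := IH Q; rewrite mulSn; lia.
Qed.

Lemma rank_fun_div n d : (0 < d)%N ->
  is_rank_fun (in_Pi1d d) (@refines n) (singletons n)
    (fun P => (n - #|P|) %/ d)%N.
Proof.
move=> d0; split=> [|P Q PQ]; first by rewrite card_singletons subnn div0n.
have /and4P [dP dQ _ _] := PQ.
have := partition_card_le (in_Pi1d_setpart dP); have PE := covers_card d0 PQ.
move=> Pn; have -> : (n - #|Q| = n - #|P| + d)%N by lia.
by rewrite divnDr ?dvdnn // divnn d0 addn1.
Qed.

(** * Forests *)

Definition forest_leaves (f : seq (GenTree.tree nat)) : seq nat :=
  flatten (map leaves f).

Definition lmax_le (t u : GenTree.tree nat) := (lmax t <= lmax u)%N.

Lemma tree_nested_ind (P : GenTree.tree nat -> Prop) :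
  (forall x, P (GenTree.Leaf x)) ->
  (forall k ts, (forall t, t \in ts -> P t) -> P (GenTree.Node k ts)) ->
  forall t, P t.
Proof.
move=> PL PN; fix IH 1 => -[x|k ts]; first exact: PL.
apply: PN; elim: ts => [|u ts IHts]; first by clear.
(* The recursive call is made on the subterm [u] only and [IH] is then cleared, so that the fixpoint
   is structural. *)
move: (IH u); clear IH => Pu t; rewrite inE.
by case/predU1P => [->|/IHts].
Qed.

Lemma mem_forest_leaves f t : t \in f -> {subset leaves t <= forest_leaves f}.
Proof. by move=> tf x xt; apply/flattenP; exists (leaves t); rewrite ?map_f. Qed.

Lemma all_forest_leaves (a : pred nat) f :
  all a (forest_leaves f) = all (fun t => all a (leaves t)) f.
Proof. by elim: f => //= t f IH; rewrite /forest_leaves /= all_cat -IH. Qed.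

Lemma forest_leaves_cat f g :
  forest_leaves (f ++ g) = forest_leaves f ++ forest_leaves g.
Proof. by rewrite /forest_leaves map_cat flatten_cat. Qed.

Lemma perm_forest_leaves f g :
  perm_eq f g -> perm_eq (forest_leaves f) (forest_leaves g).
Proof. by move=> fg; apply/perm_flatten/perm_map. Qed.

Lemma good_node d k ts : good_tree d (GenTree.Node k ts) ->
  exists a us, [/\ k = 0%N, ts = GenTree.Leaf a :: us, size us = d,
    sorted ltn (map lmax ts) & all (good_tree d) ts].
Proof.
move=> /and5P [/eqP -> /eqP]; case: ts => [|[a|j vs] us] // [sz] _ so al.
by exists a, us.
Qed.

Lemma good_leaves_gt0 d t : good_tree d t -> (0 < size (leaves t))%N.
Proof. by case: t => // k ts /good_node [a [us [_ -> _ _ _]]]. Qed.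

Lemma size_forest_leaves_le d f :
  all (good_tree d) f -> (size f <= size (forest_leaves f))%N.
Proof.
elim: f => //= t f IH /andP [gt gf]; rewrite /forest_leaves /= size_cat -add1n.
by rewrite leq_add ?IH // (good_leaves_gt0 gt).
Qed.

(** A node has [d.+1] children, each with 1 leaf modulo [d] by induction. *)
Lemma good_leaves_mod d t : good_tree d t -> size (leaves t) = 1 %[mod d].
Proof.
elim/tree_nested_ind: t => // k ts IH /good_node [a [us [_ tsE sz _ al]]].
suff E s : {subset s <= ts} -> size (forest_leaves s) = size s %[mod d].
  by rewrite /= -/(forest_leaves ts) E // tsE /= sz -addn1 modnDl.
elim: s => // t s IHs sub; rewrite /forest_leaves /= size_cat -add1n.
have tts : t \in ts by apply: sub; rewrite mem_head.
rewrite -modnDm IH //; last by apply: (allP al).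
by rewrite IHs ?modnDm // => u us'; apply: sub; rewrite inE us' orbT.
Qed.

Lemma size_forest_leaves_mod d f :
  all (good_tree d) f -> size (forest_leaves f) = size f %[mod d].
Proof.
elim: f => // t f IH /= /andP [gt gf]; rewrite /forest_leaves /= size_cat -add1n.
by rewrite -modnDm (good_leaves_mod gt) IH // modnDm.
Qed.

(** The other [d] children each have at least one leaf. *)
Lemma good_node_child d k ts t : (0 < d)%N -> good_tree d (GenTree.Node k ts) ->
  t \in ts -> (size (leaves t) < size (leaves (GenTree.Node k ts)))%N.
Proof.
move=> d0 /good_node [a [us [_ tsE sz _ al]]] tts.
rewrite /= -/(forest_leaves ts).
have /perm_forest_leaves/perm_size -> := perm_to_rem tts.
rewrite /forest_leaves /= size_cat -[X in (X < _)%N]addn0 ltn_add2l.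
apply: leq_trans (@size_forest_leaves_le d _ _).
  by rewrite size_rem // tsE /= sz.
by apply/allP => u /mem_rem; apply: (allP al).
Qed.

Lemma good_leaf d t : (0 < d)%N -> good_tree d t -> size (leaves t) = 1%N ->
  exists a, t = GenTree.Leaf a.
Proof.
case: t => [a|k ts] d0 gt; first by exists a.
have [a [us [_ tsE _ _ _]]] := good_node gt.
have := @good_node_child d k ts (GenTree.Leaf a) d0 gt.
by rewrite {1}tsE mem_head => /(_ isT) /[swap] ->.
Qed.

Lemma foldr_maxn_flatten ss :
  foldr maxn 0 (flatten ss) = foldr maxn 0 (map (foldr maxn 0) ss).
Proof.
elim: ss => //= s ss <-; elim: s => [|x s /= ->]; first by rewrite max0n.
by rewrite maxnA.
Qed.

Lemma foldr_maxn_mem s : (0 < size s)%N -> foldr maxn 0 s \in s.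
Proof.
elim: s => // x [|y s] IH _; first by rewrite /= maxn0 mem_head.
rewrite [foldr _ _ _]/=; case: leqP => _; last exact: mem_head.
by rewrite inE IH ?orbT.
Qed.

Lemma foldr_maxn_sorted x s :
  sorted ltn (x :: s) -> foldr maxn 0 (x :: s) = last x s.
Proof.
elim: s x => [|y s IH] x; first by rewrite /= maxn0.
rewrite [sorted _ _]/= => /andP [xy so].
rewrite -[foldr _ _ _]/(maxn x (foldr maxn 0 (y :: s))).
rewrite IH //; apply/maxn_idPr/ltnW.
by apply: leq_trans xy _; rewrite -IH //= leq_maxl.
Qed.

(* A root has the same lmax as its last child, so replacing the
   first tree by its children keeps the list of trees sorted. *)
Lemma sorted_lmax_node k ts r : (0 < size ts)%N -> sorted ltn (map lmax ts) ->
  sorted ltn (map lmax (GenTree.Node k ts :: r)) =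
  sorted ltn (map lmax (ts ++ r)).
Proof.
case: ts => // t ts _ so; rewrite map_cat /= cat_path.
have -> : path ltn (lmax t) (map lmax ts) by [].
congr path; rewrite -foldr_maxn_sorted //.
by rewrite {1}/lmax [leaves (GenTree.Node _ _)]/=
  (foldr_maxn_flatten (map leaves (t :: ts))) -map_comp.
Qed.

Definition toggle d (g : seq (GenTree.tree nat)) : seq (GenTree.tree nat) :=
  if g is GenTree.Node _ ts :: r then ts ++ r
  else GenTree.Node 0 (take d.+1 g) :: drop d.+1 g.

Lemma toggle_leaves d g : forest_leaves (toggle d g) = forest_leaves g.
Proof.
have merge h : forest_leaves (GenTree.Node 0 (take d.+1 h) :: drop d.+1 h) =
               forest_leaves h.
  by rewrite -[RHS](congr1 forest_leaves (cat_take_drop d.+1 h)) forest_leaves_cat.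
by case: g => [|[a|k ts] r]; rewrite ?merge // forest_leaves_cat.
Qed.

(** The condition on left-most children makes the two moves inverse: splitting a root exposes a leaf
    in front, and a new root is built only over a leaf in front. The congruence supplies enough
    trees for merging. *)
Lemma toggleP d g : (0 < d)%N -> sorted ltn (map lmax g) ->
  all (good_tree d) g -> size (forest_leaves g) = 1 %[mod d] ->
  (1 < size (forest_leaves g))%N ->
  [/\ sorted ltn (map lmax (toggle d g)), all (good_tree d) (toggle d g),
      toggle d (toggle d g) = g &
      size (toggle d g) = size g + d \/ size g = size (toggle d g) + d].
Proof.
move=> d0 so al; rewrite size_forest_leaves_mod // => sz lv.
case: g so al sz lv => [|[a|k ts] r] // so al sz lv.
(* A lone leaf would give one leaf in total, so there are at least two trees; a number above 1 that
   is 1 modulo [d] is at least [d.+1]. *)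
- have szr : (d < size (GenTree.Leaf a :: r))%N.
    apply: modn1_gt1 => //; case: r lv {so al sz} => //.
  set g := _ :: r in so al sz lv szr *.
  have tE : toggle d g = GenTree.Node 0 (take d.+1 g) :: drop d.+1 g by [].
  have szt : size (take d.+1 g) = d.+1 by rewrite size_takel.
  have sot : sorted ltn (map lmax (take d.+1 g)).
    by rewrite map_take take_sorted.
  split.
  + by rewrite tE sorted_lmax_node ?szt // cat_take_drop.
  + rewrite -[all _ _]/([&& size (take d.+1 g) == d.+1,
      sorted ltn (map lmax (take d.+1 g)) & all (good_tree d) (take d.+1 g)] &&
      all (good_tree d) (drop d.+1 g)).
    by rewrite szt eqxx sot -all_cat cat_take_drop.
  + by rewrite tE /= cat_take_drop.
  + right; have -> : size (toggle d g) = (size (drop d.+1 g)).+1 by [].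
    by rewrite size_drop; lia.
- move: al => /= /andP [gt gr].
  have [a [us [k0 tsE szu sot alt]]] := good_node gt.
  have szt : size ts = d.+1 by rewrite tsE /= szu.
  split.
  + by rewrite -(@sorted_lmax_node k) ?szt.
  + by rewrite all_cat alt.
  + rewrite k0 /toggle {1}tsE -szt take_size_cat // drop_size_cat //.
  + by left; rewrite size_cat szt /=; lia.
Qed.

(** * Sorted forests and toggling inside one block *)

Lemma uniq_lmax d f : all (good_tree d) f -> uniq (forest_leaves f) ->
  uniq (map lmax f).
Proof.
elim: f => //= t f IH /andP [gt gf]; rewrite /forest_leaves /= cat_uniq.
move=> /and3P [_ /hasPn disj uf]; rewrite IH // andbT.
apply/mapP => -[u uf' tu]; have := disj (lmax u).
have lmem v : good_tree d v -> lmax v \in leaves v.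
  by move=> gv; apply: foldr_maxn_mem (good_leaves_gt0 gv).
rewrite (mem_forest_leaves uf') ?lmem ?(allP gf) // => /(_ isT) /negP; apply.
by rewrite -tu; apply: lmem.
Qed.

Lemma sort_lmax_sorted d f : all (good_tree d) f -> uniq (forest_leaves f) ->
  sorted ltn (map lmax (sort lmax_le f)).
Proof.
move=> gf uf; rewrite ltn_sorted_uniq_leq.
rewrite (perm_uniq (perm_map lmax (permEl (perm_sort _ f)))) (uniq_lmax gf uf).
rewrite sorted_map; apply: sort_sorted => t u; exact: leq_total.
Qed.

Lemma sorted_lmax_le f : sorted ltn (map lmax f) -> sorted lmax_le f.
Proof. by rewrite sorted_map; apply: sub_sorted => t u; apply: ltnW. Qed.

Lemma sorted_lmax_inj f g : sorted ltn (map lmax f) -> sorted ltn (map lmax g) ->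
  perm_eq f g -> f = g.
Proof.
rewrite !sorted_map => sf sg fg; apply: irr_sorted_eq sf sg (perm_mem fg).
- by move=> t u v; apply: ltn_trans.
- by move=> t; apply: ltnn.
Qed.

(** This is [good_forest] with the number of trees left free, since the involution changes that
    number. *)
Definition forest_on n d f :=
  [&& sorted ltn (map lmax f), perm_eq (forest_leaves f) (iota 0 n) &
      all (good_tree d) f].

Definition in_block {n} (C : {set 'I_n}) : pred nat :=
  fun x => [exists i in C, val i == x].

Lemma in_blockE n (C : {set 'I_n}) (i : 'I_n) : in_block C i = (i \in C).
Proof.
apply/exists_inP/idP => [[j jC /eqP /val_inj <-] //|iC].
by exists i.
Qed.

Definition below_part {n} (Q : {set {set 'I_n}}) (t : GenTree.tree nat) : bool :=
  [exists C in Q, all (in_block C) (leaves t)].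

Lemma count_in_block n (C : {set 'I_n}) : count (in_block C) (iota 0 n) = #|C|.
Proof.
rewrite -val_enum_ord count_map cardE -size_filter /enum_mem.
rewrite (eq_filter (a2 := mem C)) => [|i]; last exact: in_blockE.
by rewrite -filter_predI; congr size; apply: eq_filter => i /=; rewrite andbT.
Qed.

(** Sorting restores the canonical list that represents the unordered collection. *)
Definition toggle_in n d (C : {set 'I_n}) f :=
  let p t := all (in_block C) (leaves t) in
  sort lmax_le (toggle d (filter p f) ++ filter (predC p) f).

(** As every tree lies in one block of [Q], the trees inside [C] carry exactly the labels in [C], so
    their leaf count is [#|C|], as [toggleP] requires. Toggling keeps these labels, so [C] selects
    exactly the toggled trees on the second round. *)
Lemma toggle_inP n d (Q : {set {set 'I_n}}) C f : (0 < d)%N ->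
  in_Pi1d d Q -> C \in Q -> (1 < #|C|)%N ->
  forest_on n d f -> all (below_part Q) f ->
  let f' := toggle_in d C f in
  [/\ forest_on n d f', all (below_part Q) f', toggle_in d C f' = f &
      size f' = size f + d \/ size f = size f' + d].
Proof.
move=> d0 /andP [pQ /forall_inP Qd] CQ C1 /and3P [so pe al] bel f'.
pose p t := all (in_block C) (leaves t).
set g := filter p f; set h := filter (predC p) f.
have permf : perm_eq (g ++ h) f by rewrite perm_filterC.
have lvg : forest_leaves g = filter (in_block C) (forest_leaves f).
  rewrite /g; have := bel; elim: (f) => //= t s IH /andP [bt bs].
  rewrite [in RHS]/forest_leaves /= filter_cat -/(forest_leaves s) -IH //.
  case: ifP => [pt|npt]; first by rewrite (all_filterP pt).
  (* A tree not inside [C] lies in another block of [Q], hence has no leaf in [C]. *)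
  suff -> : filter (in_block C) (leaves t) = [::] by [].
  apply/eqP; rewrite -(negbK (_ == _)) -has_filter; apply/hasPn => x xt.
  have /exists_inP [D DQ /allP tD] := bt.
  have /exists_inP [i iD /eqP ix] := tD x xt.
  apply: contraFN npt => /exists_inP [j jC /eqP jx].
  have/partition_setTP [_ _ tQ] := pQ.
  rewrite /p; have -> : C = D.
    by apply: (tQ i) => //; rewrite -(val_inj (etrans jx (esym ix))).
  exact/allP.
have szg : size (forest_leaves g) = #|C|.
  by rewrite lvg size_filter (permP pe) count_in_block.
have sog : sorted ltn (map lmax g).
  by move: so; rewrite !sorted_map; apply: sorted_filter => t u v; apply: ltn_trans.
have soh : sorted ltn (map lmax h).
  by move: so; rewrite !sorted_map; apply: sorted_filter => t u v; apply: ltn_trans.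
have alg : all (good_tree d) g.
  by rewrite all_filter; apply: sub_all al => t /= ->; rewrite implybT.
have alh : all (good_tree d) h.
  by rewrite all_filter; apply: sub_all al => t /= ->; rewrite implybT.
have [sot alt tt szt] : [/\ sorted ltn (map lmax (toggle d g)),
    all (good_tree d) (toggle d g), toggle d (toggle d g) = g &
    size (toggle d g) = size g + d \/ size g = size (toggle d g) + d].
  by apply: toggleP; rewrite ?szg //; apply/eqP/Qd.
have permf' : perm_eq f' (toggle d g ++ h) by rewrite perm_sort.
have pt : all p (toggle d g).
  by rewrite -all_forest_leaves toggle_leaves all_forest_leaves filter_all.
have ph : all (predC p) h by rewrite filter_all.
have pe' : perm_eq (forest_leaves f') (iota 0 n).
  apply: perm_trans (perm_forest_leaves permf') _.
  rewrite forest_leaves_cat toggle_leaves -forest_leaves_cat.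
  exact: perm_trans (perm_forest_leaves permf) pe.
have al' : all (good_tree d) f' by rewrite (perm_all _ permf') all_cat alt.
have so' : sorted ltn (map lmax f').
  apply: (@sort_lmax_sorted d); first by rewrite all_cat alt.
  by rewrite -(perm_uniq (perm_forest_leaves permf')) (perm_uniq pe') iota_uniq.
have le_total : total lmax_le by move=> t u; apply: leq_total.
have le_trans : transitive lmax_le by move=> t u v; apply: leq_trans.
have filt0 a s : all (predC a) s -> filter a s = [::] :> seq (GenTree.tree nat).
  by elim: s => //= t s IH /andP [/negbTE -> /IH].
split.
- exact/and3P.
- rewrite (perm_all _ permf') all_cat; apply/andP; split.
    by apply: sub_all pt => t pt; apply/exists_inP; exists C.
  by rewrite all_filter; apply: sub_all bel => t /= ->; rewrite implybT.
- have fg : filter p f' = toggle d g.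
    rewrite filter_sort // filter_cat (all_filterP pt) (filt0 _ _ ph) cats0.
    exact/sorted_sort/sorted_lmax_le.
  have fh : filter (predC p) f' = h.
    rewrite filter_sort // filter_cat (all_filterP ph) filt0 ?cat0s.
      exact/sorted_sort/sorted_lmax_le.
    by apply: sub_all pt => t /= ->.
  rewrite /toggle_in -/p fg fh tt; apply: sorted_lmax_inj => //.
    apply: (@sort_lmax_sorted d); first by rewrite all_cat alg.
    by rewrite (perm_uniq (perm_forest_leaves permf)) (perm_uniq pe) iota_uniq.
  by rewrite perm_sort.
- rewrite (perm_size permf') -(perm_size permf) !size_cat.
  by case: szt => ->; [left|right]; rewrite addnAC.
Qed.

(** * Signed enumeration of forests *)

(** Reindexing along [phi] shows that the sum equals its own negative, which for an integer means
    0. *)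
Lemma sum_sign_reversing (T : eqType) (s : seq T) (phi : T -> T) (F : T -> int) :
  uniq s ->
  (forall x, x \in s -> [/\ phi x \in s, phi (phi x) = x & F (phi x) = (- F x)%R]) ->
  (\sum_(x <- s) F x = 0)%R.
Proof.
move=> us phiP.
have perm : perm_eq (map phi s) s.
  apply: uniq_perm => //.
    rewrite map_inj_in_uniq // => x y /phiP [_ px _] /phiP [_ py _] E.
    by rewrite -px -py E.
  move=> x; apply/mapP/idP => [[y /phiP [ys _ _] ->] //|xs].
  by have [ps pp _] := phiP x xs; exists (phi x).
suff : (\sum_(x <- s) F x = - \sum_(x <- s) F x)%R by lia.
rewrite -[LHS](perm_big _ perm) big_map -sumrN big_seq [RHS]big_seq.
by apply: eq_bigr => x /phiP [].
Qed.

Lemma finite_seqs (T : eqType) (L : seq T) k : exists LL : seq (seq T),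
  forall s, (size s <= k)%N -> {subset s <= L} -> s \in LL.
Proof.
elim: k => [|k [LL LLP]]; first by exists [:: [::]] => -[].
exists ([::] :: [seq x :: s | x <- L, s <- LL]) => -[|x s] // sk sub.
rewrite inE; apply/allpairsP; exists (x, s); split => //=.
  by apply: sub; rewrite mem_head.
by apply: LLP => // y ys; apply: sub; rewrite inE ys orbT.
Qed.

(** Induction on the leaf count: children have fewer leaves than their parent, so nodes come from
    sequences of [d.+1] trees already listed. The list may contain other trees, which [enum_forests]
    filters out. *)
Lemma finite_good_trees n d N : (0 < d)%N -> exists L : seq (GenTree.tree nat),
  forall t, good_tree d t -> {subset leaves t <= iota 0 n} ->
  (size (leaves t) <= N)%N -> t \in L.
Proof.
move=> d0; elim: N => [|N [L LP]].
  by exists [::] => t /good_leaves_gt0 t0 _; rewrite leqNgt t0.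
have [LL LLP] := finite_seqs L d.+1.
exists (map (@GenTree.Leaf nat) (iota 0 n) ++ map (GenTree.Node 0) LL).
move=> [a|k ts] gt sub szN; rewrite mem_cat.
  by rewrite map_f // sub // mem_head.
have [a [us [k0 tsE szu _ al]]] := good_node gt.
rewrite k0 [X in _ || X]map_f ?orbT //; apply: LLP => [|t tts].
  by rewrite tsE /= szu.
apply: LP; first exact: (allP al).
  by move=> x xt; apply: sub; apply: mem_forest_leaves tts _ xt.
by rewrite -ltnS; apply: leq_trans szN; apply: good_node_child gt tts.
Qed.

Lemma enum_forests n d : (0 < d)%N ->
  exists L, uniq L /\ forall f, (f \in L) = forest_on n d f.
Proof.
move=> d0; have [L LP] := finite_good_trees n n d0.
have [LL LLP] := finite_seqs L n.
exists (undup (filter (forest_on n d) LL)); split; first exact: undup_uniq.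
move=> f; rewrite mem_undup mem_filter andb_idr // => /and3P [_ pe al].
have szn : size (forest_leaves f) = n by rewrite (perm_size pe) size_iota.
apply: LLP => [|t tf]; first by rewrite -[leqRHS]szn; apply: size_forest_leaves_le al.
apply: LP; first exact: (allP al).
  by move=> x xt; rewrite -(perm_mem pe) (mem_forest_leaves tf).
rewrite -[leqRHS]szn (perm_size (perm_forest_leaves (perm_to_rem tf))).
by rewrite /forest_leaves /= size_cat leq_addr.
Qed.

(** * The leaf partition of a forest *)

Definition tree_block n (t : GenTree.tree nat) : {set 'I_n} :=
  [set i | val i \in leaves t].

Definition forest_part n (f : seq (GenTree.tree nat)) : {set {set 'I_n}} :=
  [set B | B \in map (tree_block n) f].

Lemma uniq_leaves_inj f t u x : uniq (forest_leaves f) -> t \in f -> u \in f ->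
  x \in leaves t -> x \in leaves u -> t = u.
Proof.
move=> uf tf uf' xt xu; apply/eqP; apply: contraLR uf => ntu.
rewrite (perm_uniq (perm_forest_leaves (perm_to_rem tf))).
rewrite /forest_leaves /= cat_uniq !negb_and negbK; apply/orP; right.
apply/orP; left; apply/hasP; exists x => //; apply: (mem_forest_leaves _ xu).
by move: uf'; rewrite (perm_mem (perm_to_rem tf)) inE eq_sym (negbTE ntu).
Qed.

Lemma card_mem_iota n (s : seq nat) : uniq s -> {subset s <= iota 0 n} ->
  #|[set i : 'I_n | val i \in s]| = size s.
Proof.
move=> us sn; rewrite cardE -(size_map val); apply/perm_size/uniq_perm => //.
  by rewrite (map_inj_uniq val_inj) enum_uniq.
move=> x; apply/mapP/idP => [[i]|xs]; first by rewrite mem_enum inE => ? ->.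
have := sn x xs; rewrite mem_iota add0n => xn.
by exists (Ordinal (andP xn).2); rewrite ?mem_enum ?inE.
Qed.

Lemma map_lmax_leaf s : map lmax (map (@GenTree.Leaf nat) s) = s.
Proof. by elim: s => //= x s ->; rewrite /lmax /= maxn0. Qed.

Section ForestPartition.

Variables (n d : nat) (f : seq (GenTree.tree nat)).
Hypotheses (d_gt0 : (0 < d)%N) (fP : forest_on n d f).

Let pe : perm_eq (forest_leaves f) (iota 0 n). Proof. by case/and3P: fP. Qed.
Let gf : all (good_tree d) f. Proof. by case/and3P: fP. Qed.
Let uf : uniq (forest_leaves f). Proof. by rewrite (perm_uniq pe) iota_uniq. Qed.

Let leaves_sub t : t \in f -> {subset leaves t <= iota 0 n}.
Proof. by move=> tf x xt; rewrite -(perm_mem pe) (mem_forest_leaves tf). Qed.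

Lemma card_tree_block t : t \in f -> #|tree_block n t| = size (leaves t).
Proof.
move=> tf; apply: card_mem_iota (leaves_sub tf).
move: uf; rewrite (perm_uniq (perm_forest_leaves (perm_to_rem tf))).
by rewrite /forest_leaves /= cat_uniq => /andP [].
Qed.

Lemma tree_block_neq0 t : t \in f -> tree_block n t != set0.
Proof.
by move=> tf; rewrite -card_gt0 card_tree_block // (good_leaves_gt0 (allP gf _ tf)).
Qed.

Lemma card_forest_part : #|forest_part n f| = size f.
Proof.
rewrite /forest_part cardsE -(size_map (tree_block n)); apply/card_uniqP.
rewrite map_inj_in_uniq; last first.
  move=> t u tf uf' E; have /set0Pn [x] := tree_block_neq0 tf.
  move=> xt; have := xt; rewrite E; move: xt; rewrite !inE.
  exact: uniq_leaves_inj uf tf uf'.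
exact: map_uniq (uniq_lmax gf uf).
Qed.

Lemma forest_part_in_Pi1d : in_Pi1d d (forest_part n f).
Proof.
apply/andP; split; last first.
  apply/forall_inP => B; rewrite inE => /mapP [t tf ->].
  by rewrite card_tree_block // (good_leaves_mod (allP gf _ tf)).
apply/partition_setTP; split.
- rewrite inE; apply/mapP => -[t tf E].
  by have := tree_block_neq0 tf; rewrite -E eqxx.
- move=> i; have : val i \in forest_leaves f by rewrite (perm_mem pe) mem_iota add0n /=.
  move=> /flattenP [_ /mapP [t tf ->] it].
  by exists (tree_block n t); rewrite inE ?map_f.
- move=> i B C; rewrite inE => /mapP [t tf ->]; rewrite inE => /mapP [u uf' ->].
  by rewrite !inE => it iu; rewrite (uniq_leaves_inj uf tf uf' it iu).
Qed.

(** Refinement is rephrased tree by tree, the form that [toggle_inP] preserves. *)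
Lemma refines_forest_part (Q : {set {set 'I_n}}) :
  refines (forest_part n f) Q = all (below_part Q) f.
Proof.
have subE t C : t \in f -> all (in_block C) (leaves t) = (tree_block n t \subset C).
  move=> tf; apply/allP/subsetP => [tC i|tC x xt].
    by rewrite inE => /tC; rewrite in_blockE.
  have := leaves_sub tf xt; rewrite mem_iota add0n => /andP [_ xn].
  by rewrite -[x]/(val (Ordinal xn)) in_blockE tC // inE.
apply/forall_inP/allP => [fQ t tf|fQ B].
  have /exists_inP [C CQ tC] := fQ (tree_block n t) ltac:(by rewrite inE map_f).
  by apply/exists_inP; exists C; rewrite ?subE.
rewrite inE => /mapP [t tf ->]; have /exists_inP [C CQ tC] := fQ t tf.
by apply/exists_inP; exists C; rewrite -?subE.
Qed.

Lemma size_forest_le : (size f <= n)%N.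
Proof.
rewrite -card_forest_part partition_card_le //.
exact: in_Pi1d_setpart forest_part_in_Pi1d.
Qed.

(** A good tree with one leaf is a leaf, so the forest is a list of labels; sorting by [lmax] then
    forces their natural order. *)
Lemma forest_part_singletons : forest_part n f = singletons n ->
  f = map (@GenTree.Leaf nat) (iota 0 n).
Proof.
move=> fE; have leafP t : t \in f -> exists a, t = GenTree.Leaf a.
  move=> tf; apply: good_leaf d_gt0 (allP gf _ tf) _; rewrite -card_tree_block //.
  have : tree_block n t \in singletons n by rewrite -fE inE map_f.
  by case/imsetP => i _ ->; rewrite cards1.
have fl : f = map (@GenTree.Leaf nat) (forest_leaves f).
  elim: (f) leafP => // t s IH leafP.
  have [a ->] := leafP t (mem_head _ _); rewrite /forest_leaves /= -IH // => u us.
  by apply: leafP; rewrite inE us orbT.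
rewrite {1}fl; congr map; apply: (irr_sorted_eq ltn_trans ltnn).
- by case/and3P: fP => so _ _; move: so; rewrite {1}fl map_lmax_leaf.
- exact: iota_ltn_sorted.
- exact: perm_mem pe.
Qed.

End ForestPartition.

Lemma forest_on_leaves n d : forest_on n d (map (@GenTree.Leaf nat) (iota 0 n)).
Proof.
apply/and3P; split.
- by rewrite map_lmax_leaf iota_ltn_sorted.
- rewrite /forest_leaves -map_comp.
  by rewrite (eq_map (g := fun a => [:: a])) // flatten_seq1.
- by rewrite all_map; apply/allP.
Qed.

(** * The Moebius function as a signed count of forests *)

Section SignedForests.

Variables (n d : nat) (L : seq (seq (GenTree.tree nat))).
Hypotheses (d_gt0 : (0 < d)%N) (L_uniq : uniq L).
Hypothesis LP : forall f, (f \in L) = forest_on n d f.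

(** For a forest on [n] labels the exponent is the number of internal vertices: each joins [d.+1]
    trees into one and so lowers the number of trees by [d]. *)
Definition forest_sign (f : seq (GenTree.tree nat)) : int :=
  ((-1) ^+ ((n - size f) %/ d))%R.

Lemma forest_signD f g : forest_on n d g -> size g = size f + d ->
  forest_sign f = (- forest_sign g)%R.
Proof.
move=> /size_forest_le gn sg; rewrite /forest_sign.
have -> : (n - size f = n - size g + d)%N by lia.
by rewrite divnDr ?dvdnn // divnn d_gt0 addn1 exprS mulN1r.
Qed.

Lemma leaves_forestP f : f \in L ->
  (forest_part n f == singletons n) = (f == map (@GenTree.Leaf nat) (iota 0 n)).
Proof.
rewrite LP => fP; apply/eqP/eqP => [|fE]; first exact: forest_part_singletons fP.
apply: partition_card_eq.
  exact: in_Pi1d_setpart (forest_part_in_Pi1d fP).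
by rewrite (card_forest_part fP) fE size_map size_iota.
Qed.

Definition signed_forests (P : {set {set 'I_n}}) : int :=
  (\sum_(f <- L | forest_part n f == P) forest_sign f)%R.

Lemma signed_forests_singletons : signed_forests (singletons n) = 1%R.
Proof.
pose f0 := map (@GenTree.Leaf nat) (iota 0 n).
have f0L : f0 \in L by rewrite LP forest_on_leaves.
rewrite /signed_forests big_mkcond (bigD1_seq f0) //= leaves_forestP // eqxx.
rewrite big1_seq ?addr0 => [|f /andP [/negbTE ff0 fL]]; last first.
  by rewrite leaves_forestP // ff0.
by rewrite /forest_sign size_map size_iota subnn div0n.
Qed.

(** These equations determine the Moebius function from the minimum. Forests with leaf partition
    below [Q] cancel in pairs by toggling inside a block [C] of size above 1; for the singletons
    only the forest of [n] leaves remains. *)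
Lemma sum_signed_forests Q : in_Pi1d d Q ->
  (\sum_(P | in_Pi1d d P && refines P Q) signed_forests P)%R =
  (Q == singletons n)%:R%R.
Proof.
move=> dQ.
(* Each forest contributes to exactly one [P], its leaf partition. *)
have -> : (\sum_(P | in_Pi1d d P && refines P Q) signed_forests P =
           \sum_(f <- L | all (below_part Q) f) forest_sign f)%R.
  rewrite /signed_forests (exchange_big_dep xpredT) //= [RHS]big_mkcond.
  rewrite big_seq [RHS]big_seq; apply: eq_bigr => f; rewrite LP => fP.
  rewrite -(refines_forest_part fP) big_mkcond (bigD1 (forest_part n f)) //=.
  rewrite eqxx andbT (forest_part_in_Pi1d fP) big1 ?addr0 // => P.
  by rewrite eq_sym => /negbTE ->; rewrite andbF.
have [->|Q1] := eqVneq Q (singletons n).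
  rewrite -signed_forests_singletons /signed_forests big_seq_cond [RHS]big_seq_cond.
  apply: eq_bigl => f; apply: andb_id2l => fL; have := fL; rewrite LP => fP.
  rewrite -(refines_forest_part fP); apply/idP/eqP => [le1|->]; last exact: refines_refl.
  (* A leaf partition strictly below the singletons would have more than [n] blocks. *)
  have df := forest_part_in_Pi1d fP; apply/eqP; apply: contraTT le1 => ne.
  apply/negP => le1.
  have := refines_lt_card df (singletons_partition n); rewrite /plt le1 ne.
  by move=> /(_ isT); rewrite card_singletons ltnNge partition_card_le
    ?(in_Pi1d_setpart df).
have pQ := in_Pi1d_setpart dQ.
have [C CQ C1] : exists2 C, C \in Q & (1 < #|C|)%N.
  apply/exists_inP; apply: contraNT Q1 => /exists_inPn noC.
  apply/eqP/partition_card_eq => //; apply/eqP; rewrite eqn_leq partition_card_le //=.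
  have := card_partition pQ; rewrite cardsT card_ord => {1}->.
  by rewrite -[leqRHS]sum1_card leq_sum // => C /noC; rewrite -leqNgt.
rewrite -big_filter mulr0n; apply: (@sum_sign_reversing _ _ (toggle_in d C)).
  exact: filter_uniq.
move=> f; rewrite mem_filter LP => /andP [bel fP].
have [fP' bel' invf sz] := toggle_inP d_gt0 dQ CQ C1 fP bel.
rewrite mem_filter LP fP' bel'; split=> //; case: sz => sz.
  by rewrite (forest_signD fP' sz) opprK.
exact: forest_signD sz.
Qed.

(** By [sum_signed_forests] the signed counts satisfy the recursion that defines [mobius0];
    induction on the fuel concludes. *)
Lemma mobius0_forests P : in_Pi1d d P ->
  mobius0 (in_Pi1d d) (@refines n) (singletons n) P = signed_forests P.
Proof.
move=> dP.
(* The fuel suffices: there are [2 ^ (2 ^ n)] sets of sets, more than [n], and each recursive call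
   goes to a partition with more blocks. *)
have : (n - #|P| < #|{: {set {set 'I_n}}}|)%N.
  have card_sets (T : finType) : #|{: {set T}}| = (2 ^ #|T|)%N.
    by rewrite -[in LHS]cardsT -powersetT card_powerset cardsT.
  rewrite !card_sets card_ord; apply: leq_ltn_trans (leq_subr _ _) _.
  by apply: ltn_trans (ltn_expl n (ltnSn 1)) _; apply: ltn_expl.
rewrite /mobius0; elim: #|_| P dP => // N IH P dP PN /=.
have [->|P1] := eqVneq; first by rewrite signed_forests_singletons.
have := sum_signed_forests dP; rewrite (negbTE P1) (bigD1 P) ?dP ?refines_refl //=.
move=> /eqP; rewrite addr_eq0 => /eqP ->; congr (- _)%R.
apply: eq_big => [Z|Z /and3P [dZ _ ZP]].
  rewrite /plt -andbA; apply: andb_id2l => dZ.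
  by rewrite refines_singletons // (in_Pi1d_setpart dZ).
apply: IH => //.
have := refines_lt_card dZ (in_Pi1d_setpart dP) ZP.
by have := partition_card_le (in_Pi1d_setpart dZ); lia.
Qed.

End SignedForests.

(** * Whitney numbers *)

(** Blocks are nonempty, which supplies the positivity in [S1d]. The case [m = 0] is set aside
    because [stirS] is 0 there by convention. *)
Lemma stirS_S1d d n m : (0 < m)%N -> stirS (S1d d) n (Posz m) =
  #|[set P : {set {set 'I_n}} | in_Pi1d d P & #|P| == m]|.
Proof.
case: m => // m _ /=; apply: eq_card => P; rewrite !inE /in_Pi1d -andbA.
apply: andb_id2l => pP; rewrite andbC; congr andb.
apply: eq_forallb_in => B BP; rewrite /S1d card_gt0.
by case/and3P: pP => _ _ P0; rewrite (contraNneq _ P0) // => <-.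
Qed.

Lemma sum_mobius0_below n d (Q : {set {set 'I_n}}) : (0 < d)%N -> in_Pi1d d Q ->
  (\sum_(P | in_Pi1d d P && refines P Q)
     mobius0 (in_Pi1d d) (@refines n) (singletons n) P)%R =
  (Q == singletons n)%:R%R.
Proof.
move=> d0 dQ; have [L [L_uniq LP]] := enum_forests n d0.
rewrite -(sum_signed_forests d0 L_uniq LP dQ); apply: eq_bigr => P /andP [dP _].
exact: mobius0_forests.
Qed.

(** Indexing by the number of blocks instead of the rank makes these numbers matrix entries. *)
Definition whitney1_blocks d n m : int :=
  (\sum_(P | in_Pi1d d P && (#|P| == m))
     mobius0 (in_Pi1d d) (@refines n) (singletons n) P)%R.

(** Sum [mobius0 P] over all pairs of [P] below [Q] with [#|Q| = m]. For fixed [P], [card_above]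
    counts the [Q] by a Stirling number; for fixed [Q], the sum over [P] is 0 unless [Q] is the
    partition into singletons, which has [n] blocks. *)
Lemma whitney1_blocks_stirS d n m N : (0 < d)%N -> (0 < n <= N)%N -> (0 < m)%N ->
  (\sum_(j < N) whitney1_blocks d n j.+1 * (stirS (S1d d) j.+1 (Posz m))%:Z)%R =
  (n == m)%:R%R.
Proof.
move=> d0 /andP [n0 nN] m0.
transitivity (\sum_(Q : {set {set 'I_n}} | in_Pi1d d Q && (#|Q| == m))
                (Q == singletons n)%:R : int)%R; last first.
  have [nm|nm] := eqVneq n m.
    rewrite (bigD1 (singletons n)) ?in_Pi1d_singletons ?card_singletons ?nm //=.
    by rewrite eqxx big1 ?addr0 // => Q /andP [_ /negbTE ->].
  rewrite big1 // => Q /andP [_ Qm]; case: eqP => // QE.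
  by move: Qm; rewrite QE card_singletons (negbTE nm).
transitivity (\sum_(P | in_Pi1d d P)
    mobius0 (in_Pi1d d) (@refines n) (singletons n) P *
    (stirS (S1d d) #|P| (Posz m))%:Z)%R.
  (* Group the [P] by number of blocks; the index [j] stands for [j.+1] blocks. *)
  under eq_bigr => j _ do rewrite /whitney1_blocks mulr_suml.
  rewrite (exchange_big_dep (in_Pi1d d)) /= => [|j P _ /andP [] //].
  apply: eq_bigr => P dP; have pP := in_Pi1d_setpart dP.
  have P0 := partition_card_gt0 n0 pP.
  have PN : (#|P|.-1 < N)%N by have := partition_card_le pP; lia.
  rewrite (big_pred1 (Ordinal PN)) => [|j /=]; first by rewrite /= prednK.
  rewrite dP /=; apply/eqP/eqP => [Pj|->]; last by rewrite /= prednK.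
  by apply: val_inj; rewrite /= Pj.
rewrite [RHS](eq_bigr _ (fun Q dQ => esym (sum_mobius0_below d0 (andP dQ).1))).
rewrite [RHS](exchange_big_dep (in_Pi1d d)) => [|Q P _ /andP [] //].
apply: eq_bigr => P dP; rewrite stirS_S1d // -(card_above m dP).
rewrite -[X in (_ * X)%R]natz mulr_natr -sumr_const.
apply: eq_bigl => Q; rewrite !inE dP /= -andbA; congr andb; exact: andbC.
Qed.

(** The matrix [W] is a left inverse of the square Stirling matrix, hence its inverse. *)
Lemma stirS_inv_S1d d n m : (0 < d)%N -> (0 < m <= n)%N ->
  stirS_inv (S1d d) n (Posz m) = whitney1_blocks d n m.
Proof.
case: n => [|n] d0 mn; first by lia.
rewrite /stirS_inv mn.
set M := (X in invmx X).
pose W := (\matrix_(i < n.+1, j < n.+1) whitney1_blocks d i.+1 j.+1)%R.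
have WM : (W *m M = 1%:M)%R.
  apply/matrixP => i j; rewrite !mxE.
  under eq_bigr => l _ do rewrite !mxE.
  by rewrite whitney1_blocks_stirS ?ltn_ord.
have [_ uM] := mulmx1_unit WM.
have -> : invmx M = W by rewrite -[LHS]mul1mx -WM mulmxK.
(* Rows and columns are numbered from 0, so [n.+1] and [m] sit at positions [n] and [m.-1]. *)
by rewrite mxE !inordK ?prednK //; lia.
Qed.

(** Stated in integers because [n - k * d] may be negative; then no element has rank [k]. *)
Lemma rank_fun_eq n d r k (P : {set {set 'I_n}}) : (0 < d)%N ->
  is_rank_fun (in_Pi1d d) (@refines n) (singletons n) r -> in_Pi1d d P ->
  (r P == k) = (Posz #|P| == n%:Z - (k * d)%N%:Z)%R.
Proof.
move=> d0 rr dP; have := rank_fun_card d0 rr dP => E.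
by rewrite -(eqn_pmul2r d0); apply/eqP/eqP; lia.
Qed.

Theorem theorem1p2 (n d k : nat) (hn : (1 <= n)%N) (hd : (1 <= d)%N) :
  ranked (@in_Pi1d n d) (@refines n) (singletons n) /\
  (forall r : {set {set 'I_n}} -> nat,
     is_rank_fun (@in_Pi1d n d) (@refines n) (singletons n) r ->
     ((whitney2 (@in_Pi1d n d) r k)%:Z%R
        = (stirS (S1d d) n (n%:Z%R - (k * d)%N%:Z%R))%:Z%R)%R /\
     whitney1 (@in_Pi1d n d) (@refines n) (singletons n) r k
        = stirS_inv (S1d d) n (n%:Z%R - (k * d)%N%:Z%R) /\
     (exists fs : seq (seq (GenTree.tree nat)),
        [/\ uniq fs,
            (forall f, f \in fs <-> good_forest n d (n%:Z%R - (k * d)%N%:Z%R) f) &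
            whitney1 (@in_Pi1d n d) (@refines n) (singletons n) r k
              = ((-1) ^+ k * (size fs)%:Z%R)%R])).
Proof.
split; first by eexists; apply: rank_fun_div hd.
move=> r rr.
have rankE (P : {set {set 'I_n}}) : in_Pi1d d P ->
    (r P == k) = (Posz #|P| == n%:Z - (k * d)%N%:Z)%R.
  exact: rank_fun_eq.
have blocks_gt0 (P : {set {set 'I_n}}) : in_Pi1d d P -> (0 < #|P|)%N.
  by move=> /in_Pi1d_setpart; apply: partition_card_gt0.
have w1E : whitney1 (@in_Pi1d n d) (@refines n) (singletons n) r k =
    (\sum_(P | in_Pi1d d P && (Posz #|P| == n%:Z - (k * d)%N%:Z))
       mobius0 (in_Pi1d d) (@refines n) (singletons n) P)%R.
  by apply: eq_bigl => P; apply: andb_id2l => /rankE.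
split; [|split].
- have -> : whitney2 (@in_Pi1d n d) r k =
      #|[set P : {set {set 'I_n}} | in_Pi1d d P & (Posz #|P| == n%:Z - (k * d)%N%:Z)%R]|.
    by apply: eq_card => P; rewrite !inE; apply: andb_id2l => /rankE.
  (* If [n - k * d] is 0 or negative, both sides are 0, because a partition of [[n]] with [n >= 1]
     has at least one block. *)
  case: (n%:Z - _)%R => [[|m]|m]; last 2 first.
  + by rewrite stirS_S1d.
  + by rewrite eq_card0 // => P; rewrite !inE andbF.
  + rewrite eq_card0 // => P; rewrite !inE.
    by apply/andP => -[/blocks_gt0]; rewrite eqz_nat; case: #|P|.
(* The bound by [n] puts a positive [n - k * d] in the range where [stirS_inv] reads a matrix
   entry. *)
- rewrite w1E; have : (n%:Z - (k * d)%N%:Z <= n%:Z)%R by lia.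
  case: (n%:Z - _)%R => [[|m]|m] mn; last 2 first.
  + by rewrite stirS_inv_S1d.
  + by rewrite big_pred0 => [|P]; rewrite ?andbF //; case: (n).
  + rewrite big_pred0 => [|P]; first by case: (n).
    by apply/andP => -[/blocks_gt0]; rewrite eqz_nat; case: #|P|.
- have [L [L_uniq LP]] := enum_forests n hd.
  pose sized (f : seq (GenTree.tree nat)) := (Posz (size f) == n%:Z - (k * d)%N%:Z)%R.
  exists (filter sized L); split; first exact: filter_uniq.
    by move=> f; rewrite mem_filter LP.
  rewrite w1E.
  rewrite (eq_bigr _ (fun P dP => mobius0_forests hd L_uniq LP (andP dP).1)).
  rewrite /signed_forests (exchange_big_dep xpredT) //=.
  transitivity (\sum_(f <- L | sized f) forest_sign n d f)%R.
    rewrite [RHS]big_mkcond [LHS]big_seq_cond [RHS]big_seq_cond.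
    apply: eq_bigr => f /andP [+ _].
    rewrite LP => fP; rewrite big_mkcond (bigD1 (forest_part n f)) //=.
    rewrite eqxx andbT (forest_part_in_Pi1d fP) (card_forest_part fP) big1 ?addr0 // => P.
    by rewrite eq_sym => /negbTE ->; rewrite andbF.
  rewrite -natz size_filter -sum1_count natr_sum mulr_sumr; apply: eq_bigr => f.
  rewrite mulr1 /forest_sign => /eqP fk; congr (_ ^+ _)%R.
  (* A forest of [n - k * d] trees has sign exponent [(k * d) %/ d], which is [k]. *)
  have <- : (size f + k * d = n)%N by apply/eqP; rewrite -eqz_nat PoszD fk subrK.
  by rewrite addKn mulnK.
Qed.
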